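(* Let $K$ be a number field of degree $d$ with $s$ Archimedean places, and suppose that $r=s-1\ge1$. For every $n=1,\dots,r$, $$\rho_\infty(K)\ge\frac{d}{s}\,\mu_K(n)^{1/n}.$$ In particular, $\rho_\infty(K)\ge\frac{d}{s}\,b(\mathcal{O}_K^\times)$.
   Context: Let $K$ have $r_1$ real embeddings $\sigma_1,\dots,\sigma_{r_1}$ and $r_2$ pairs of complex conjugate embeddings, represented by $\sigma_{r_1+1},\dots,\sigma_{r_1+r_2}$; then $s=r_1+r_2$, and $r=s-1$ is the rank of $\mathcal{O}_K^\times$. The logarithmic embedding $\ell:K^\times\to\mathbb{R}^s$ is $\ell(x)=(\log|\sigma_1(x)|,\dots,\log|\sigma_{r_1}(x)|,2\log|\sigma_{r_1+1}(x)|,\dots,2\log|\sigma_{r_1+r_2}(x)|)$, and $\Lambda_K=\ell(\mathcal{O}_K^\times)$, a lattice of rank $r$ in $\mathbb{R}^s$. The covering radius is $\rho_\infty(K)=\sup_{v\in\mathrm{span}_{\mathbb R}(\Lambda_K)}\min_{w\in\Lambda_K}\|v-w\|_\infty$, where $\|\cdot\|_\infty$ is the sup norm on $\mathbb{R}^s$. $h$ denotes the absolute logarithmic Weil height; for an algebraic integer $x\in\mathcal{O}_K$, $h(x)=\frac1d\sum_{\sigma}\max\{0,\log|\sigma(x)|\}$, the sum being over all $d$ embeddings $\sigma:K\to\mathbb{C}$ (with $\log 0=-\infty$). For $n=1,\dots,r$, $\mu_K(n)=\inf\big(h(v_1)\cdots h(v_n)\big)$, the infimum being over all multiplicatively independent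 $v_1,\dots,v_n\in\mathcal{O}_K^\times$. For a set $\mathcal{A}$ of algebraic numbers, $b(\mathcal{A})=\inf\{h(x)\mid x\in\mathcal{A},\ x\ne0,\ x\text{ not a root of unity}\}$. *)

(* Defs.v *)
From mathcomp Require Import all_boot all_order all_algebra all_field.
From mathcomp Require Import all_classical all_reals all_analysis.
From mathcomp Require Import complex.

Set Implicit Arguments.
Unset Strict Implicit.
Unset Printing Implicit Defensive.

Import Order.TTheory GRing.Theory Num.Theory.
Import numFieldNormedType.Exports.

Local Open Scope classical_set_scope.
Local Open Scope ring_scope.
Local Open Scope complex_scope.

Definition integers (K : fieldExtType rat) : set K :=
  [set x | integralOver (intr : int -> K) x].

Definition int_units (K : fieldExtType rat) : set K :=
  [set x | integers x /\ exists2 y, integers y & x * y = 1].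

Arguments int_units : clear implicits.

(* The r1 real embeddings are sigma_0, ..., sigma_(r1 - 1); the other r2 are one
   representative of each pair of complex conjugate embeddings. Thus r1 + r2 is
   the number of Archimedean places of K. *)
Record archimedean_embeddings (R : realType) (K : fieldExtType rat)
    (r1 r2 : nat) (sigma : 'I_(r1 + r2) -> {rmorphism K -> R[i]}) : Prop := {
  arch_real : forall (i : 'I_r1) (x : K),
    complex.Im (sigma (lshift r2 i) x) = 0;
  arch_complex : forall j : 'I_r2,
    exists x : K, complex.Im (sigma (rshift r1 j) x) != 0;
  arch_exhaustive : forall tau : {rmorphism K -> R[i]}, exists i,
    (forall x, tau x = sigma i x) \/ (forall x, tau x = (sigma i x)^*%C);
  arch_distinct : forall i j,
    (forall x, sigma i x = sigma j x) \/ (forall x, sigma i x = (sigma j x)^*%C) ->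
    i = j }.

Definition log_embedding (R : realType) (K : fieldExtType rat) (r1 r2 : nat)
    (sigma : 'I_(r1 + r2) -> {rmorphism K -> R[i]}) (x : K) : 'rV[R]_(r1 + r2) :=
  \row_i ((if (i < r1)%N then 1 else 2) * ln (Normc.normc (sigma i x))).

Definition log_unit_lattice (R : realType) (K : fieldExtType rat) (r1 r2 : nat)
    (sigma : 'I_(r1 + r2) -> {rmorphism K -> R[i]}) : set 'rV[R]_(r1 + r2) :=
  log_embedding sigma @` int_units K.

Definition real_span (R : realType) (s : nat) (L : set 'rV[R]_s) :
    set 'rV[R]_s :=
  [set v | exists (m : nat) (c : 'I_m -> R) (u : 'I_m -> 'rV[R]_s),
     (forall i, L (u i)) /\ v = \sum_(i < m) c i *: u i].

(* `|_| on 'rV[R]_s is the sup norm. The inner inf is attained when L is a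
   lattice. *)
Definition covering_radius (R : realType) (s : nat) (L : set 'rV[R]_s) : R :=
  sup [set inf [set `|v - w| | w in L] | v in real_span L].

(* All complex embeddings of K, as bare functions, so that equal maps are
   counted once. *)
Definition embeddings (R : realType) (K : fieldExtType rat) : set (K -> R[i]) :=
  [set tau : K -> R[i] | exists f : {rmorphism K -> R[i]}, tau = f :> (K -> R[i])].

Arguments embeddings : clear implicits.

(* This is the absolute logarithmic Weil height only when x is an algebraic
   integer. The convention log 0 = -oo is harmless here: ln 0 = 0 also
   contributes max 0 (ln 0) = 0. *)
Definition height (R : realType) (K : fieldExtType rat) (x : K) : R :=
  (\dim {:K})%:R^-1 *
  \sum_(tau \in embeddings R K) Num.max 0 (ln (Normc.normc (tau x))).

Arguments height R {K} x.

Definition mult_independent (K : fieldExtType rat) (n : nat) (v : 'I_n -> K) :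
    Prop :=
  forall a : 'I_n -> int, \prod_(i < n) v i ^ a i = 1 -> forall i, a i = 0.

Definition mu (R : realType) (K : fieldExtType rat) (n : nat) : R :=
  inf [set \prod_(i < n) height R (v i) | v in
        [set v : 'I_n -> K | (forall i, int_units K (v i)) /\
                             mult_independent v]].

Definition is_root_of_unity (K : fieldExtType rat) (x : K) : Prop :=
  exists2 n : nat, (0 < n)%N & n.-unity_root x.

(* A is meant to consist of algebraic integers; see height. *)
Definition min_height (R : realType) (K : fieldExtType rat) (A : set K) : R :=
  inf [set height R x | x in [set x | A x /\ x != 0 /\ ~ is_root_of_unity x]].

(* Main.v *)
Require Import Defs.
From mathcomp Require Import all_boot all_order all_algebra all_field.
From mathcomp Require Import all_classical all_reals all_analysis.
From mathcomp Require Import complex.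
From mathcomp Require Import ring lra.

(* Walking from 0 to l(u) in small steps and approximating each step by a lattice
   point shows that the unit group is generated by the units x with
   |l(x)| <= 2 rho + e. One of x and x^-1 has coordinate sum <= 0, and for it
   d h(x) <= sum_i max(0, l_i(x)) <= |l(x)|_1 / 2 <= s (rho + e / 2). Hence
   n independent units can be exchanged one by one for independent units of height
   at most (s / d) (rho + e). The argument uses neither Dirichlet's unit theorem nor
   the product formula: when there are no n independent units, mu(n) is the infimum
   of the empty set, which is 0. *)

Set Implicit Arguments.
Unset Strict Implicit.
Unset Printing Implicit Defensive.

Import Order.TTheory GRing.Theory Num.Theory.
Import numFieldNormedType.Exports.

Local Open Scope ring_scope.
Local Open Scope complex_scope.

(** * Covering radius of an additive subgroup of a finite-dimensional real space *)

Section Covering.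
Variables (R : realType) (s : nat) (L : set 'rV[R]_s).
Hypotheses (L0 : L 0) (LB : forall x y, L x -> L y -> L (x - y)).

Let LD x y : L x -> L y -> L (x + y).
Proof. by move=> Lx Ly; rewrite -[y]opprK; apply: LB => //; rewrite -[- y]add0r; exact: LB. Qed.

Let L_sumz m (u : 'I_m -> 'rV[R]_s) (a : 'I_m -> int) :
  (forall i, L (u i)) -> L (\sum_i u i *~ a i).
Proof.
move=> Lu; apply: (big_ind L) => // i _.
have Ln n : L (u i *+ n) by elim: n => [|n IH]; rewrite ?mulr0n // mulrS; exact: LD.
case: (a i) => n; first exact: Ln.
by rewrite NegzE mulrNz -[- _]add0r; apply: LB => //; exact: (Ln n.+1).
Qed.

(** Take a free family in [L] of maximal size, which the ambient dimension bounds; a point of [L]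
    outside its span could be adjoined to it. *)
Lemma exists_free_spanning :
  exists2 X : seq 'rV[R]_s, {in X, forall x, L x} &
    free X /\ forall x, L x -> x \in <<X>>%VS.
Proof.
pose P m := `[< exists X : seq 'rV[R]_s,
  [/\ size X = m, {in X, forall x, L x} & free X] >].
have P0 : exists m, P m by exists 0%N; apply/asboolP; exists [::]; rewrite nil_free.
have Pub m : P m -> (m <= \dim {:'rV[R]_s})%N.
  by move/asboolP => [X [<- _ /eqP <-]]; exact: dimvS (subvf _).
case: (ex_maxnP P0 Pub) => m /asboolP[X [szX LX freeX]] maxX.
exists X => //; split=> // x Lx; apply: contraT => xNX.
suff /maxX : P m.+1 by rewrite ltnn.
apply/asboolP; exists (x :: X); rewrite free_cons xNX freeX /= szX; split=> //.
by move=> y; rewrite inE => /orP[/eqP->|/LX].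
Qed.

(** Rounding the coordinates down leaves a remainder with coordinates in [[0, 1)]. This bound makes
    the [sup] in [covering_radius] a genuine supremum rather than a default value. *)
Lemma real_span_distance_bounded : exists B : R, forall v, real_span L v ->
  exists2 w, L w & `|v - w| <= B.
Proof.
have [X LX [freeX spanX]] := exists_free_spanning.
have LXi (i : 'I_(size X)) : L (in_tuple X)`_i by apply: LX; exact: mem_nth.
exists (\sum_(i < size X) `|(in_tuple X)`_i|) => v [m [c [u [Lu ->]]]].
set v' := \sum_(_ < _) _.
have vX : v' \in <<in_tuple X>>%VS.
  by apply: memv_suml => i _; apply: memvZ; exact: spanX.
exists (\sum_(i < size X) (in_tuple X)`_i *~ Num.floor (coord (in_tuple X) i v')).
  exact: L_sumz.
rewrite {1}(coord_span vX) -sumrB; apply: le_trans (ler_norm_sum _ _ _) _.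
apply: ler_sum => i _; set t := coord _ _ _.
rewrite -scaler_int -scalerBl normrZ ler_piMl //.
rewrite ger0_norm ?subr_ge0 ?floor_le // lerBlDl.
by have := ltW (floorD1_gt t); rewrite intrD.
Qed.

Let dist v := [set `|v - w| | w in L]%classic.

Let dist_lb v : has_lbound (dist v).
Proof. by exists 0 => _ [w _ <-]. Qed.

Let dist_radius : has_sup [set inf (dist v) | v in real_span L]%classic.
Proof.
split; first by exists (inf (dist 0)), 0 => //; exists 0%N, (fun=> 0), (fun=> 0);
  rewrite big_ord0.
have [B HB] := real_span_distance_bounded.
exists B => _ [v /HB [w Lw vw] <-]; apply: le_trans vw.
by apply: ge_inf => //; exists w.
Qed.

Lemma covering_radius_ge0 : 0 <= covering_radius L.
Proof.
have span0 : real_span L 0.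
  by exists 0%N, (fun=> 0), (fun=> 0); rewrite big_ord0.
apply: (@le_trans _ _ (inf (dist 0))); last first.
  by apply: sup_upper_bound dist_radius _ _; exists 0.
by apply: lb_le_inf => [|_ [w _ <-]//]; exists `|(0 : 'rV[R]_s) - 0|, 0.
Qed.

(** The slack [e] stands in for attainment of the infimum of distances. *)
Lemma covering_radius_approx v (e : R) : 0 < e -> real_span L v ->
  exists2 w, L w & `|v - w| < covering_radius L + e.
Proof.
move=> e0 Lv; have : has_inf (dist v) by split=> //; exists `|v - 0|, 0.
case/(inf_adherent e0) => _ [w Lw <-] vw; exists w => //.
by apply: lt_le_trans vw _; rewrite lerD2r; apply: sup_upper_bound dist_radius _ _; exists v.
Qed.

End Covering.

(** * Units, multiplicative independence and exchange *)

Section Units.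
Variable K : fieldExtType rat.

Lemma int_units_neq0 x : int_units K x -> x != 0.
Proof.
move=> [_ [y _ xy]]; apply: contra_eq_neq xy => ->.
by rewrite mul0r eq_sym oner_neq0.
Qed.

Lemma int_units1 : int_units K 1.
Proof. by split; [|exists 1; rewrite ?mulr1 //]; exact: integral1. Qed.

Lemma int_unitsV x : int_units K x -> int_units K x^-1.
Proof.
move=> Ux; have x0 := int_units_neq0 Ux; case: Ux => Ix [y Iy xy].
have -> : x^-1 = y by rewrite -[y](mulKf x0) xy mulr1.
by split=> //; exists x => //; rewrite mulrC.
Qed.

Lemma int_unitsM x y : int_units K x -> int_units K y -> int_units K (x * y).
Proof.
move=> [Ix [x' Ix' xx']] [Iy [y' Iy' yy']]; split; first exact: integral_mul.
by exists (x' * y'); [exact: integral_mul | rewrite mulrACA xx' yy' mulr1].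
Qed.

Lemma int_units_div x y : int_units K x -> int_units K y -> int_units K (x / y).
Proof. by move=> Ux /int_unitsV; exact: int_unitsM. Qed.

Lemma prod_exprzDr n (v : 'I_n -> K) (a b : 'I_n -> int) :
  (forall i, v i != 0) ->
  \prod_i v i ^ (a i + b i) = (\prod_i v i ^ a i) * \prod_i v i ^ b i.
Proof.
by move=> v0; rewrite -big_split; apply: eq_bigr => i _; rewrite expfzDr.
Qed.

Lemma prod_exprzM n (v : 'I_n -> K) (a : 'I_n -> int) (k : int) :
  \prod_i v i ^ (a i * k) = (\prod_i v i ^ a i) ^ k.
Proof.
rewrite [RHS](big_morph (fun x : K => x ^ k) (id1 := 1) (op1 := *%R)).
- by apply: eq_bigr => i _; rewrite exprz_exp.
- by move=> x y; rewrite expfzMl.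
- by rewrite exp1rz.
Qed.

Section Exchange.
Variables (n : nat) (v : 'I_n -> K).
Hypotheses (v0 : forall i, v i != 0) (indep_v : mult_independent v).

(** The multiplicative analogue of a rational span: [a i = 0] discards the generator [v i], and the
    exponent [k] admits roots, in particular all roots of unity. *)
Definition isolated_span (i : 'I_n) (y : K) : Prop :=
  exists k : int, exists a : 'I_n -> int,
    [/\ k != 0, a i = 0 & y ^ k = \prod_j v j ^ a j].

Lemma isolated_span1 i : isolated_span i 1.
Proof. by exists 1, (fun=> 0); split=> //; rewrite big1 // exp1rz. Qed.

Lemma isolated_span_div i y z :
  isolated_span i y -> isolated_span i z -> isolated_span i (y / z).
Proof.
move=> [k [a [k0 ai yk]]] [l [b [l0 bi zl]]].
exists (k * l), (fun j => a j * l + b j * - k).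
split; [by rewrite mulf_neq0 | by rewrite ai bi !mul0r |].
rewrite prod_exprzDr // !prod_exprzM -yk -zl expfzMl -!exprz_exp.
by congr (_ * _); rewrite exprzAC exprz_inv -[RHS]exprz_inv invr_expz.
Qed.

Lemma isolated_span_not_self i : ~ isolated_span i (v i).
Proof.
move=> [k [a [k0 ai vk]]]; move/eqP: k0; apply.
(* Dividing the relation by [v i ^ k] gives a relation whose exponent at [i] is [- k]. *)
suff /indep_v/(_ i) : \prod_j v j ^ (a j + (if j == i then - k else 0)) = 1.
  by rewrite eqxx ai add0r => /eqP; rewrite oppr_eq0 => /eqP.
rewrite prod_exprzDr // -vk [X in _ * X](bigD1 i) //= eqxx big1 => [|j /negPf->//].
by rewrite mulr1 -expfzDr // subrr.
Qed.

(** In a relation of the new family, a nonzero exponent of [x] would serve as [k] and put [x] in the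
    hull; once it vanishes, a relation among the [v j] remains. *)
Lemma mult_independent_replace i x : x != 0 -> ~ isolated_span i x ->
  mult_independent (fun j => if j == i then x else v j).
Proof.
move=> x0 Nx a; rewrite (bigD1 i) //= eqxx => xa.
have ai : a i = 0.
  apply/eqP; apply: contra_notT Nx => ai.
  exists (a i), (fun j => (if j == i then 0 else a j) * -1).
  split; rewrite ?eqxx ?mul0r // prod_exprzM [\prod_j _](bigD1 i) //= eqxx expr0z mul1r.
  apply: (@mulIf _ (\prod_(j < n | j != i) v j ^ (if j == i then 0 else a j))).
    apply/prodf_neq0 => j _; exact: expfz_neq0.
  rewrite exprN1 mulVf; last by apply/prodf_neq0 => j _; exact: expfz_neq0.
  by rewrite -[RHS]xa; congr (_ * _); apply: eq_bigr => j /negPf ->.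
apply: indep_v; rewrite (bigD1 i) //= -[RHS]xa ai !expr0z; congr (_ * _).
by apply: eq_bigr => j /negPf ->.
Qed.

End Exchange.

(* Independence is tested in the divisible hulls of the subgroups generated by
   the [v j], [j <> i]; each such hull misses [v i], so it must miss an element
   of the generating set [P], which can then replace [v i]. *)
Lemma mult_independent_exchange n (P : K -> Prop) (v : 'I_n -> K) :
  (forall D : K -> Prop, D 1 -> (forall x y, D x -> D y -> D (x / y)) ->
     (forall x, int_units K x -> P x -> D x) -> forall x, int_units K x -> D x) ->
  (forall i, int_units K (v i)) -> mult_independent v ->
  exists w : 'I_n -> K,
    [/\ forall i, int_units K (w i), mult_independent w & forall i, P (w i)].
Proof.
move=> genP Uv indep_v.
(* The entries are replaced in order; [m] counts those already in [P]. *)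
suff H m : (m <= n)%N -> exists w : 'I_n -> K, [/\ forall i, int_units K (w i),
    mult_independent w & forall i : 'I_n, (i < m)%N -> P (w i)].
  by have [w [Uw indep_w Pw]] := H n (leqnn n); exists w; split=> // i; exact: Pw.
elim: m => [|m IH] mn; first by exists v.
have [w [Uw indep_w Pw]] := IH (ltnW mn); pose i := Ordinal mn.
have w0 j : w j != 0 := int_units_neq0 (Uw j).
have [x [Ux Px Nx]] : exists x, [/\ int_units K x, P x & ~ isolated_span w i x].
  apply: contrapT => H; apply: (@isolated_span_not_self _ _ w0 indep_w i).
  apply: genP (Uw i); first exact: isolated_span1.
    exact: isolated_span_div.
  by move=> x Ux Px; apply: contrapT => Nx; apply: H; exists x.
exists (fun j => if j == i then x else w j); split.
- by move=> j; case: ifP.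
- exact: mult_independent_replace (int_units_neq0 Ux) Nx.
- move=> j; rewrite ltnS; case: eqVneq => // ji jm; apply: Pw.
  by rewrite ltn_neqAle jm andbT; apply: contra ji => /eqP ji; apply/eqP/val_inj.
Qed.

End Units.

(** Each head of [s] is cancelled against one occurrence in [t]; uniqueness in [s] keeps the
    remaining entries available. *)
Lemma ler_sum_subseq (R : numDomainType) (I : eqType) (s t : seq I) (F : I -> R) :
  (forall i, 0 <= F i) -> uniq s -> {subset s <= t} ->
  \sum_(i <- s) F i <= \sum_(i <- t) F i.
Proof.
move=> F0; elim: s t => [|i s IH] t /=; first by rewrite big_nil sumr_ge0.
move=> /andP[iNs uniq_s] st; rewrite big_cons [leRHS](big_rem i) ?st ?mem_head //=.
rewrite lerD2l IH // => j js; have := st j; rewrite inE js orbT => /(_ isT) jt.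
have /perm_mem/(_ j) := perm_to_rem (st i (mem_head i s)).
rewrite jt inE => /esym/orP[/eqP ji|//].
by rewrite -ji js in iNs.
Qed.

(** * The logarithmic embedding and generation by short units *)

Section LogEmbedding.
Variables (R : realType) (K : fieldExtType rat) (r1 r2 : nat).
Variable sigma : 'I_(r1 + r2) -> {rmorphism K -> R[i]}.

Local Notation ell := (log_embedding sigma).

Let normc_gt0 i x : x != 0 -> 0 < Normc.normc (sigma i x).
Proof.
move=> x0; rewrite lt_neqAle eq_sym; apply/andP; split.
  by apply/eqP => /Normc.eq0_normc/eqP; rewrite fmorph_eq0 (negPf x0).
by case: (sigma i x) => a b /=; exact: sqrtr_ge0.
Qed.

Lemma log_embedding_div x y : x != 0 -> y != 0 -> ell (x / y) = ell x - ell y.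
Proof.
move=> x0 y0; apply/rowP => i; rewrite !mxE -mulrBr; congr (_ * _).
by rewrite fmorph_div Normc.normcM Normc.normcV ln_div // posrE normc_gt0.
Qed.

Lemma log_embedding1 : ell 1 = 0.
Proof. by rewrite -(divr1 1) log_embedding_div ?oner_neq0 // subrr. Qed.

Lemma log_unit_lattice0 : log_unit_lattice sigma 0.
Proof. by exists 1; [exact: int_units1 | exact: log_embedding1]. Qed.

Lemma log_unit_latticeB v w : log_unit_lattice sigma v ->
  log_unit_lattice sigma w -> log_unit_lattice sigma (v - w).
Proof.
move=> [x Ux <-] [y Uy <-]; exists (x / y); first exact: int_units_div.
by rewrite log_embedding_div ?int_units_neq0.
Qed.

Local Notation rho := (covering_radius (log_unit_lattice sigma)).

Let rho_ge0 : 0 <= rho.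
Proof.
by apply: covering_radius_ge0; [exact: log_unit_lattice0 | exact: log_unit_latticeB].
Qed.

(* Approximate the points of a fine subdivision of the segment from 0 to
   [ell u] by elements of [ell D]: consecutive approximations differ by short
   units. *)
Lemma short_units_generate (e : R) (D : K -> Prop) : 0 < e ->
  D 1 -> (forall x y, D x -> D y -> D (x / y)) ->
  (forall x, int_units K x -> `|ell x| <= 2 * rho + e -> D x) ->
  forall u, int_units K u -> D u.
Proof.
move=> e0 D1 Ddiv Dshort u Uu.
have DM x y : D x -> D y -> D (x * y).
  by move=> Dx Dy; rewrite -[y]invrK -[y^-1]div1r; apply: (Ddiv) => //; exact: Ddiv.
(* Two approximation errors below [rho + d] and one step of length at most [d] add up to at most
   [2 * rho + e]. *)
pose d := e / 3; have d0 : 0 < d by rewrite divr_gt0.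
pose N := (Num.truncn (`|ell u| / d)).+1.
have uN : `|ell u| / N%:R <= d.
  by rewrite ler_pdivrMr ?ltr0n // mulrC -ler_pdivrMr // ltW // truncnS_gt.
have approx k : exists w, [/\ int_units K w, D w &
    `|(k%:R / N%:R) *: ell u - ell w| < rho + d].
  elim: k => [|k [w [Uw Dw wk]]].
    exists 1; split=> //; first exact: int_units1.
    rewrite mul0r scale0r log_embedding1 subrr normr0.
    by rewrite ltr_wpDl ?rho_ge0.
  have [_ [w' Uw' <-] w'k] : exists2 w', log_unit_lattice sigma w' &
      `|(k.+1%:R / N%:R) *: ell u - w'| < rho + d.
    apply: covering_radius_approx => //.
    - exact: log_unit_lattice0.
    - exact: log_unit_latticeB.
    - exists 1%N, (fun=> k.+1%:R / N%:R), (fun=> ell u).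
      by split; [move=> _; exists u | rewrite big_ord1].
  exists w'; split=> //; rewrite -(divfK (int_units_neq0 Uw) w'); apply: DM => //.
  apply: Dshort; first exact: int_units_div.
  rewrite log_embedding_div ?int_units_neq0 //.
  have -> : ell w' - ell w = ((k%:R / N%:R) *: ell u - ell w)
      - ((k.+1%:R / N%:R) *: ell u - ell w') + N%:R^-1 *: ell u.
    rewrite -[k.+1]addn1 natrD mulrDl mul1r scalerDl.
    by apply/rowP => i; rewrite !mxE; ring.
  have dN : `|N%:R^-1 *: ell u| <= d.
    by rewrite normrZ mulrC ger0_norm // invr_ge0.
  have := ler_normD ((k%:R / N%:R) *: ell u - ell w
      - ((k.+1%:R / N%:R) *: ell u - ell w')) (N%:R^-1 *: ell u).
  have := ler_normB ((k%:R / N%:R) *: ell u - ell w)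
      ((k.+1%:R / N%:R) *: ell u - ell w').
  have : d * 3 = e by rewrite /d; field.
  by move: wk w'k dN => *; lra.
(* The walk ends near [ell u], so [u / w] is itself short; this recovers [u] and not merely its
   image under [ell]. *)
have [w [Uw Dw]] := approx N.
rewrite divff ?pnatr_eq0 // scale1r => uw.
rewrite -(divfK (int_units_neq0 Uw) u); apply: DM => //.
apply: Dshort; first exact: int_units_div.
rewrite log_embedding_div ?int_units_neq0 //.
have rho0 := rho_ge0.
have : d * 3 = e by rewrite /d; field.
by move=> ?; lra.
Qed.

(** * Heights of units and the resulting bounds *)

Hypothesis Hsigma : archimedean_embeddings sigma.

(** The list [E] of all [sigma i] and the conjugates of the complex ones contains every embedding,
    since real embeddings are their own conjugates; the weight 2 accounts for the conjugates. *)
Lemma sum_embeddings_le (F : (K -> R[i]) -> R) : (forall tau, 0 <= F tau) ->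
  (forall tau, F (fun x => (tau x)^*%C) = F tau) ->
  \sum_(tau \in embeddings R K) F tau <=
  \sum_(i < r1 + r2) (if (i < r1)%N then 1 else 2) * F (sigma i).
Proof.
move=> F0 Fconj.
pose E := [seq (sigma i : K -> R[i]) | i <- index_enum 'I_(r1 + r2)] ++
  [seq (fun x => (sigma i x)^*%C) | i : 'I_(r1 + r2) <- index_enum 'I_(r1 + r2) & ~~ (i < r1)%N].
have sub_E tau : embeddings R K tau -> tau \in E.
  move=> [f ->]; rewrite mem_cat; apply/orP.
  have [i [eq_f|eq_f]] := arch_exhaustive Hsigma f.
    by left; apply/mapP; exists i; [rewrite mem_index_enum | exact/funext].
  case: (ltnP i r1) => ir.
    left; apply/mapP; exists i; [by rewrite mem_index_enum | apply/funext => x].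
    have := arch_real Hsigma (Ordinal ir) x.
    rewrite (_ : lshift r2 _ = i); last exact/val_inj.
    by rewrite eq_f; case: (sigma i x) => a b /= ->; rewrite oppr0.
  right; apply/mapP; exists i; last exact/funext.
  by rewrite mem_filter mem_index_enum -leqNgt ir.
(* A sum with infinite support would be 0 by default, so finiteness must be shown before the sum is
   expanded. *)
have finE : finite_set (embeddings R K).
  by apply: sub_finite_set (finite_seq E) => tau; exact: sub_E.
rewrite fsbig_finite //=.
have -> : \sum_(i < r1 + r2) (if (i < r1)%N then 1 else 2) * F (sigma i) = \sum_(tau <- E) F tau.
  rewrite big_cat /= !big_map big_filter [X in _ + X]big_mkcond /= -big_split /=.
  apply: eq_bigr => i _; rewrite Fconj; case: ifP => _ /=; first by rewrite mul1r addr0.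
  by rewrite mulr_natl mulr2n.
apply: ler_sum_subseq => //.
  exact: finmap.fset_uniq.
by move=> tau; rewrite in_fset_set // inE => /sub_E.
Qed.

(** By [max 0 t = (|t| + t) / 2], the weighted positive parts sum to half of the l1 norm plus the
    coordinate sum; the latter is dropped by its sign, and the l1 norm is at most [r1 + r2] times
    the sup norm. *)
Lemma height_le x : int_units K x -> \sum_i ell x 0 i <= 0 ->
  (\dim {:K})%:R * height R x <= (r1 + r2)%:R / 2 * `|ell x|.
Proof.
move=> Ux sum_le0; rewrite /height mulVKf; last by rewrite pnatr_eq0 -lt0n adim_gt0.
pose F (tau : K -> R[i]) : R := Num.max 0 (ln (Normc.normc (tau x))).
have F0 tau : 0 <= F tau by rewrite /F le_max lexx.
have Fconj tau : F (fun y => (tau y)^*%C) = F tau.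
  by rewrite /F; case: (tau x) => a b /=; rewrite sqrrN.
apply: le_trans (sum_embeddings_le F0 Fconj) _.
have -> : \sum_(i < r1 + r2) (if (i < r1)%N then 1 else 2) * F (sigma i) =
    (\sum_i `|ell x 0 i| + \sum_i ell x 0 i) / 2.
  rewrite -big_split mulr_suml /=; apply: eq_bigr => i _; rewrite /F !mxE.
  set t := ln _; set c : R := if _ then _ else _.
  have c0 : 0 < c by rewrite /c; case: ifP.
  case: (leP 0 t) => t0.
    by rewrite ger0_norm ?(mulr_ge0 (ltW c0)) //; field.
  by rewrite mulr0 ltr0_norm ?addNr ?mul0r // pmulr_rlt0.
rewrite mulrAC ler_pM2r ?invr_gt0 //.
apply: (@le_trans _ _ (\sum_(i < r1 + r2) `|ell x 0 i|)).
  by rewrite gerDl.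
rewrite mulr_natl -[X in _ *+ X]card_ord -sumr_const; apply: ler_sum => i _.
by rewrite [leRHS]mx_normrE (le_bigmax _ (fun ij => `|ell x ij.1 ij.2|) (0, i)).
Qed.

(* Of a short unit and its inverse, one satisfies the sign condition of
   [height_le]; this replaces the product formula. *)
Lemma low_units_generate (e : R) (D : K -> Prop) : 0 < e ->
  D 1 -> (forall x y, D x -> D y -> D (x / y)) ->
  (forall x, int_units K x ->
     height R x <= (r1 + r2)%:R / (\dim {:K})%:R * (rho + e) -> D x) ->
  forall u, int_units K u -> D u.
Proof.
move=> e0 D1 Ddiv Dlow.
have Dneg x : int_units K x -> `|ell x| <= 2 * rho + 2 * e ->
    \sum_i ell x 0 i <= 0 -> D x.
  move=> Ux xs /(height_le Ux) hx; apply: (Dlow) => //.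
  rewrite mulrAC ler_pdivlMr ?ltr0n ?adim_gt0 // mulrC; apply: le_trans hx _.
  rewrite -mulrA ler_wpM2l //; lra.
apply: (@short_units_generate (2 * e)) => //; first by rewrite mulr_gt0.
move=> x Ux xs; case: (leP (\sum_i ell x 0 i) 0) => [|pos]; first exact: Dneg.
have ellV : ell x^-1 = - ell x.
  by rewrite -div1r log_embedding_div ?oner_neq0 ?int_units_neq0 // log_embedding1 sub0r.
rewrite -[x]invrK -div1r; apply: (Ddiv) => //; apply: Dneg.
- exact: int_unitsV.
- by rewrite ellV normrN.
- under eq_bigr do rewrite ellV mxE.
  by rewrite sumrN oppr_le0 ltW.
Qed.

Lemma height_ge0 (x : K) : 0 <= height R x.
Proof.
rewrite mulr_ge0 ?invr_ge0 //; apply: fsumr_ge0 => tau _.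
by rewrite le_max lexx.
Qed.

Lemma mu_le (e : R) n (v : 'I_n -> K) : 0 < e ->
  (forall i, int_units K (v i)) -> mult_independent v ->
  mu R K n <= ((r1 + r2)%:R / (\dim {:K})%:R * (rho + e)) ^+ n.
Proof.
move=> e0 Uv indep_v.
have [w [Uw indep_w hw]] := mult_independent_exchange
  (fun D D1 Ddiv => low_units_generate e0 D1 Ddiv) Uv indep_v.
apply: (@le_trans _ _ (\prod_(i < n) height R (w i))).
  apply: ge_inf; last by exists w.
  by exists 0 => _ [w' _ <-]; apply: prodr_ge0 => i _; exact: height_ge0.
rewrite -[X in _ ^+ X]card_ord -prodr_const; apply: ler_prod => i _.
by rewrite height_ge0 hw.
Qed.

Lemma mu_ge0 n : 0 <= mu R K n.
Proof.
rewrite /mu; set S := [set _ | _ in _]%classic.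
have [->|S0] := pselect (S = set0); first by rewrite inf0.
apply: lb_le_inf; first exact/set0P/eqP.
by move=> _ [w _ <-]; apply: prodr_ge0 => i _; exact: height_ge0.
Qed.

Lemma covering_radius_ge_mu n : (0 < r1 + r2)%N -> (0 < n)%N ->
  (\dim {:K})%:R / (r1 + r2)%:R * mu R K n `^ n%:R^-1 <= rho.
Proof.
move=> s0 n0; set d : R := _%:R; set s : R := _%:R.
have d_gt0 : 0 < d by rewrite ltr0n adim_gt0.
have s_gt0 : 0 < s by rewrite ltr0n.
have rho0 := rho_ge0.
have [[v [Uv indep_v]]|none] := pselect (exists v : 'I_n -> K,
    (forall i, int_units K (v i)) /\ mult_independent v); last first.
  rewrite /mu (_ : [set _ | _ in _]%classic = set0); last first.
    by apply/seteqP; split=> // y [v Uv _]; case: none; exists v.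
  (* [powR 0 0] is 1, so the power vanishes only because [n] is positive. *)
  by rewrite inf0 powR0 ?mulr0 // invr_eq0 pnatr_eq0 -lt0n.
apply/ler_addgt0Pr => e e0.
have se0 : 0 <= s / d * (rho + e).
  by rewrite mulr_ge0 ?divr_ge0 ?addr_ge0 // ltW.
rewrite mulrC -ler_pdivlMr ?divr_gt0 // invf_div mulrC.
(* The right side becomes the [n]-th root of its [n]-th power, and monotonicity of the root reduces
   the goal to [mu_le]. *)
rewrite -[leRHS]powRr1 // -[1 in leRHS](@mulfV _ n%:R) ?pnatr_eq0 -?lt0n //.
rewrite powRrM powR_mulrn // ge0_ler_powR ?nnegrE ?invr_ge0 ?mu_ge0 ?exprn_ge0 //.
exact: mu_le e0 Uv indep_v.
Qed.

(** A single unit is multiplicatively independent exactly when it is not a root of unity, so both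
    infima range over the same set. *)
Lemma min_height_units : min_height R (int_units K) = mu R K 1.
Proof.
congr inf; apply/seteqP; split=> y [x].
  move=> [Ux [x0 Nx]] <-; exists (fun=> x); last by rewrite big_ord1.
  split=> // a; rewrite big_ord1 => xa i; rewrite ord1; apply/eqP.
  (* The exponent may be negative; inverting the relation makes it positive. *)
  apply: contra_notT Nx => a0; exists `|a ord0|%N; first by rewrite absz_gt0.
  apply/unity_rootP; case: (a ord0) xa => k //=.
  by rewrite NegzE -invr_expz => /(congr1 GRing.inv); rewrite invrK invr1.
move=> [Ux indep_x] <-; exists (x 0); last by rewrite big_ord1.
split; [exact: Ux | split; first exact: int_units_neq0 (Ux _)].
move=> [k k0 /unity_rootP xk].
have : (k : int) = 0 by apply: (indep_x (fun=> k) _ 0); rewrite big_ord1.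
by move=> [k_eq0]; rewrite k_eq0 in k0.
Qed.

End LogEmbedding.

Theorem theorem3p5 (R : realType) (K : fieldExtType rat) (r1 r2 : nat)
    (sigma : 'I_(r1 + r2) -> {rmorphism K -> R[i]})
    (Hsigma : archimedean_embeddings sigma)
    (Hr : (1 <= r1 + r2 - 1)%N) :
  let d : R := (\dim {:K})%:R in
  let s : R := (r1 + r2)%:R in
  let rho : R := covering_radius (log_unit_lattice sigma) in
  (forall n : nat, (1 <= n <= r1 + r2 - 1)%N ->
     rho >= d / s * (mu R K n) `^ (n%:R^-1)) /\
  rho >= d / s * min_height R (int_units K).
Proof.
have s0 : (0 < r1 + r2)%N by move: Hr; rewrite subn_gt0 => /ltnW.
split=> [n /andP[n0 _]|]; first exact: covering_radius_ge_mu.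
rewrite min_height_units -[mu R K 1]powRr1 ?mu_ge0 // -[X in _ `^ X]invr1.
exact: (@covering_radius_ge_mu R K r1 r2 sigma Hsigma 1%N).
Qed.
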